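(* Every connected cobipartite graph $G$ with at least two vertices has a spanning even tree, except when $G$ is isomorphic to the complete graph on two vertices, to a path on four vertices, or to a cycle on four vertices.
   Context: All graphs are finite and simple. A cobipartite graph is the complement of a bipartite graph. A leaf of a tree is a vertex of degree $1$. A tree is even if for every pair of distinct leaves, the number of edges of the unique path between them is even. A spanning even tree of $G$ is a spanning tree of $G$ that is even. *)

(* Defs.v *)
From mathcomp Require Import all_boot.

Set Implicit Arguments.
Unset Strict Implicit.
Unset Printing Implicit Defensive.

(* A finite simple graph is a symmetric irreflexive relation on a finType of
   vertices. *)

Definition simple_graph (T : finType) (e : rel T) : Prop :=
  symmetric e /\ irreflexive e.

Definition complement_graph (T : finType) (e : rel T) : rel T :=
  [rel x y | (x != y) && ~~ e x y].

Definition bipartite (T : finType) (e : rel T) : Prop :=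
  exists A : {set T}, forall x y, e x y -> (x \in A) != (y \in A).

Definition cobipartite (T : finType) (e : rel T) : Prop :=
  exists h : rel T,
    [/\ simple_graph h, bipartite h & e =2 complement_graph h].

Definition connected_graph (T : finType) (e : rel T) : Prop :=
  forall x y, connect e x y.

(* In a simple graph, a uniq closed walk of size at most 2 is a vertex or an
   edge traversed back and forth, hence the bound on the size of a cycle. *)
Definition acyclic (T : finType) (e : rel T) : Prop :=
  forall c : seq T, 2 < size c -> ~ ucycle e c.

Definition tree (T : finType) (t : rel T) : Prop :=
  [/\ simple_graph t, connected_graph t & acyclic t].

Definition degree (T : finType) (e : rel T) (x : T) : nat := #|[set y | e x y]|.

Definition leaf (T : finType) (t : rel T) (x : T) : bool := degree t x == 1.

(* The walk x :: p has size p edges; in a tree there is exactly one p as below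
   for given x and y. *)
Definition even_leaf_paths (T : finType) (t : rel T) : Prop :=
  forall x y, leaf t x -> leaf t y -> x != y ->
  forall p : seq T, path t x p -> last x p = y -> uniq (x :: p) ->
  ~~ odd (size p).

Definition even_tree (T : finType) (t : rel T) : Prop :=
  tree t /\ even_leaf_paths t.

Definition has_spanning_even_tree (T : finType) (e : rel T) : Prop :=
  exists t : rel T, subrel t e /\ even_tree t.

Definition graph_iso (T S : finType) (e : rel T) (h : rel S) : Prop :=
  exists2 f : T -> S, bijective f & forall x y, h (f x) (f y) = e x y.

Definition complete_graph (n : nat) : rel 'I_n := [rel i j | i != j].

Definition path_graph (n : nat) : rel 'I_n :=
  [rel i j : 'I_n | (i.+1 == j :> nat) || (j.+1 == i :> nat)].

(* Only meaningful for 2 < n. *)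
Definition cycle_graph (n : nat) : rel 'I_n :=
  [rel i j : 'I_n | (i.+1 %% n == j :> nat) || (j.+1 %% n == i :> nat)].

Arguments complete_graph n _ _ : clear implicits.
Arguments path_graph n _ _ : clear implicits.
Arguments cycle_graph n _ _ : clear implicits.

(* Main.v *)
Require Import Defs.
From mathcomp Require Import all_boot.

Set Implicit Arguments.
Unset Strict Implicit.
Unset Printing Implicit Defensive.

(** Let the vertices be covered by two cliques [A] and [B], and call the two
    colour classes of a tree [X] and [Y]: the tree is even as soon as every
    leaf lies in [X]. A universal vertex yields a star, whose centre is not a
    leaf when there are at least three vertices. Without universal vertex, both
    cliques have at least two elements; if [x] in [A] is adjacent to [y2] in
    [B] and [A] has a third vertex, take [y1] in [A] other than [x], join [y1]
    to the rest of [A], [y2] to the rest of [B], and [x] to [y2]: then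
    [Y = {y1, y2}] contains no leaf. The remaining case is that of two cliques
    of size two, where the absence of a universal vertex forces the edges
    between them to form a matching, which gives a path or a cycle. *)

(** * Trees encoded by a parent function *)

Definition parent_graph {T : finType} (r : T) (p : T -> T) : rel T :=
  [rel x y | (x != r) && (p x == y) || (y != r) && (p y == x)].

Section RootedTrees.

Variables (T : finType) (r : T) (p : T -> T) (d : T -> nat).
(** [d] need not be the distance to the root: any measure that drops from child to parent forces the
    iterates of [p] to reach [r]. *)
Hypothesis d_parent : forall x, x != r -> d (p x) < d x.

Lemma parent_graph_sym : symmetric (parent_graph r p).
Proof. by move=> x y; exact: orbC. Qed.

Lemma parent_graph_irr : irreflexive (parent_graph r p).
Proof.
move=> x; rewrite /parent_graph /= orbb; apply/negP => /andP[/d_parent dx /eqP px].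
by rewrite px ltnn in dx.
Qed.

Lemma parent_graph_connected : connected_graph (parent_graph r p).
Proof.
have to_r x : connect (parent_graph r p) x r.
  have [n] := ubnP (d x); elim: n x => // n IHn x /ltnSE le_dx_n.
  have [->|x_neq_r] := eqVneq x r; first exact: connect0.
  apply: (@connect_trans _ _ (p x)).
    by apply: connect1; rewrite /parent_graph /= x_neq_r eqxx.
  by apply: IHn; apply: leq_trans le_dx_n; apply: d_parent.
move=> x y; apply: connect_trans (to_r x) _.
by rewrite (sym_connect_sym parent_graph_sym) to_r.
Qed.

Lemma parent_graph_max x y :
  parent_graph r p x y -> d y <= d x -> y = p x.
Proof.
by case/orP=> /andP[y_neq_r /eqP <- //] le_d; have := d_parent y_neq_r; rewrite ltnNge le_d.
Qed.

(* Both neighbours on a cycle of a vertex of maximal depth are its parent. *)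
Lemma parent_graph_acyclic : acyclic (parent_graph r p).
Proof.
move=> c c_gt2 cyc_c.
have [x0 x0c] : exists x, x \in c by case: c c_gt2 {cyc_c} => // x c; exists x; rewrite mem_head.
have [x xc x_max] := @arg_maxnP _ x0 (mem c) d x0c.
have [i s rot_c] := rot_to xc.
have mem_c z : z \in x :: s -> d z <= d x by rewrite -rot_c mem_rot => /x_max.
move: c_gt2 cyc_c; rewrite -(size_rot i) -(rot_ucycle i) rot_c.
(* [y] follows [x] on the cycle and [z] precedes it; the length bound makes them two separate
   entries, so [y = z] will contradict uniqueness. *)
case: s {rot_c} mem_c => // y; case/lastP => // s z mem_c _ /andP[].
rewrite (cycle_path x) /= last_rcons => /and3P[zx xy _].
have -> : y = p x by apply: parent_graph_max xy _; rewrite mem_c // !inE eqxx orbT.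
have -> : z = p x.
  by apply: parent_graph_max; rewrite 1?parent_graph_sym // mem_c // !inE mem_rcons mem_head !orbT.
by rewrite mem_rcons mem_head /= andbF.
Qed.

(** [c] is a proper 2-colouring, true on the class that is to contain all leaves; [branching] gives
    degree at least two to the other class. *)
Variable c : T -> bool.
Hypothesis c_parent : forall x, x != r -> c (p x) = ~~ c x.
Hypothesis branching : forall x, ~~ c x ->
  exists y z, [/\ y != z, parent_graph r p x y & parent_graph r p x z].

(** The colour flips along each edge, so the parity of a walk is read off the colours of its ends,
    and leaves all have colour [true]. *)
Lemma parent_graph_even_tree : even_tree (parent_graph r p).
Proof.
split.
  split; [|exact: parent_graph_connected|exact: parent_graph_acyclic].
  by split; [exact: parent_graph_sym|exact: parent_graph_irr].
have c_edge x y : parent_graph r p x y -> c y = ~~ c x.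
  by case/orP=> /andP[/c_parent + /eqP e_p]; rewrite e_p // => ->; rewrite negbK.
have c_leaf x : leaf (parent_graph r p) x -> c x.
  apply: contraLR => /branching[y [z [yz xy xz]]].
  rewrite /leaf /degree neq_ltn; apply/orP; right.
  by apply/card_gt1P; exists y, z; rewrite !inE xy xz.
have c_path q x : path (parent_graph r p) x q -> c (last x q) = c x (+) odd (size q).
  elim: q x => [|y q IHq] x; first by rewrite addbF.
  by case/andP=> /c_edge cy /IHq /= ->; rewrite cy addNb addbN.
move=> x y /c_leaf cx /c_leaf cy _ q /c_path + last_q _.
by rewrite last_q cx cy /= => /esym.
Qed.

End RootedTrees.

(** * Spanning even trees from two covering cliques *)

Definition universal {T : finType} (e : rel T) (u : T) : bool :=
  [forall x, (x != u) ==> e u x].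

Section CobipartiteGraphs.

Variables (T : finType) (e : rel T).
Hypothesis e_sym : symmetric e.

Lemma star_spanning_even_tree u :
  universal e u -> 2 < #|T| -> has_spanning_even_tree e.
Proof.
move=> /forallP u_univ T_gt2.
exists (parent_graph u (fun=> u)); split.
  by move=> x y /orP[]/andP[x_neq /eqP <-]; [rewrite e_sym|]; apply: implyP (u_univ _) x_neq.
(* The same function serves as depth (0 at the centre, 1 elsewhere) and as colour, so only the
   centre has to branch. *)
apply: (@parent_graph_even_tree _ _ _ (fun x => x != u) _ (fun x => x != u)).
- by move=> x ->; rewrite eqxx.
- by move=> x ->; rewrite eqxx.
move=> x /negPn/eqP ->.
have /card_gt1P[y [z [yu zu yz]]] : 1 < #|[set~ u]| by rewrite cardsC1; case: #|T| T_gt2.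
by exists y, z; rewrite !inE in yu zu; rewrite /parent_graph /= yu zu eqxx orbT.
Qed.

(** Comparing memberships treats [A] and its complement alike, so that the two cliques can be
    exchanged. *)
Definition two_cliques (A : {set T}) : Prop :=
  forall x y, x != y -> (x \in A) = (y \in A) -> e x y.

Lemma two_cliquesC A : two_cliques A -> two_cliques (~: A).
Proof. by move=> AB x y xy; rewrite !inE => /negb_inj; apply: AB. Qed.

(** The root [r] is the vertex [y1] of the overview and [y] is [y2]. The leaf-free class is
    [{r, y}]: [r] has the neighbours [x] and [w], and [y] has [x] and [z]. *)
Lemma double_star_spanning_even_tree (A : {set T}) x y :
  two_cliques A -> x \in A -> y \notin A -> e x y -> 2 < #|A| -> 1 < #|~: A| ->
  has_spanning_even_tree e.
Proof.
move=> AB xA yA xy A_gt2 B_gt1.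
have /card_gt1P[r [w [rA wA rw]]] : 1 < #|A :\ x|.
  by rewrite (cardsD1 x) xA in A_gt2.
have /card_gt0P[z zB] : 0 < #|~: A :\ y|.
  by rewrite (cardsD1 y) inE yA in B_gt1.
move: rA wA zB; rewrite !inE => /andP[rx rA] /andP[wx wA] /andP[zy zA].
have neqA u v : u \in A -> v \notin A -> (u == v) = false.
  by move=> uA; apply: contraNF => /eqP <-.
(* The levels are [r], then the rest of [A], then [y] hanging from [x], then the rest of the
   complement hanging from [y]. *)
pose p v := if v == y then x else if v \in A then r else y.
pose d v := if v == r then 0 else if v == y then 2 else if v \in A then 1 else 3.
have ep v : v != r -> e v (p v).
  move=> vr; rewrite /p; case: eqP => [->|/eqP vy]; first by rewrite e_sym.
  case: ifP => vA; apply: AB => //; first by rewrite vA rA.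
  by rewrite vA (negPf yA).
exists (parent_graph r p); split.
  by move=> u v /orP[]/andP[vr /eqP <-]; [|rewrite e_sym]; apply: ep.
have yr : (y == r) = false by rewrite eq_sym neqA.
have xr : (x == r) = false by rewrite eq_sym (negPf rx).
apply: (@parent_graph_even_tree _ _ _ d _ (fun v => (v != r) && (v != y))).
- move=> v vr; rewrite /d (negPf vr) /p; have [_|vy] := eqVneq v y.
    by rewrite xr (neqA _ _ xA yA) xA.
  by case: (v \in A); rewrite ?eqxx ?yr.
- move=> v vr; rewrite vr /p /=; have [_|vy] := eqVneq v y; first by rewrite xr (neqA _ _ xA yA).
  by case: (v \in A); rewrite ?eqxx ?andbF.
move=> v; rewrite negb_and !negbK => /orP[]/eqP ->.
  exists x, w; rewrite eq_sym wx /parent_graph /= /p xr (neqA _ _ xA yA) (neqA _ _ wA yA) xA wA.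
  by rewrite (eq_sym w) rw eqxx !orbT.
exists x, z; rewrite /parent_graph neqA //= /p (negPf zy) (negPf zA) yr !eqxx /= andbT.
by rewrite (eq_sym z) (neqA _ _ rA zA) orbT.
Qed.

Hypothesis e_conn : connected_graph e.

(** Otherwise [A] would be closed under adjacency, and no path could lead from [x] to [y]. *)
Lemma crossing_edge (A : {set T}) x y :
  x \in A -> y \notin A -> exists u v, [/\ u \in A, v \notin A & e u v].
Proof.
move=> xA yA.
have [/exists_inP[u uA /exists_inP[v]]|no_edge] :=
  boolP [exists u in A, exists v in ~: A, e u v].
  by rewrite inE => vA uv; exists u, v.
have A_closed : closed e (mem A).
  apply: (intro_closed (sym_connect_sym e_sym)) => u v uv uA.
  apply: contraR no_edge => vA.
  by apply/exists_inP; exists u => //; apply/exists_inP; exists v; rewrite ?inE.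
by have := closed_connect A_closed (e_conn x y); rewrite /= xA (negPf yA).
Qed.

(** If [A] is empty, the whole graph is a clique and [x0] is universal. If [A] is a singleton,
    either it is the whole graph, or its vertex has by connectivity a neighbour in the other clique,
    and that neighbour is universal. *)
Lemma clique_gt1 (x0 : T) (A : {set T}) :
  two_cliques A -> (forall u, ~~ universal e u) -> 1 < #|A|.
Proof.
move=> AB no_univ; rewrite ltnNge; apply/negP => A_le1.
have [A0|[x xA]] := set_0Vmem A.
  case/negP: (no_univ x0); apply/forallP => y; apply/implyP => yx0.
  by apply: AB; rewrite 1?eq_sym // A0 !inE.
have A1 : A = [set x] by apply/esym/eqP; rewrite eqEcard sub1set xA cards1.
have [y yA|B0] := pickP [predC A]; last first.
  case/negP: (no_univ x); apply/forallP => y; apply/implyP => yx; apply: AB; rewrite 1?eq_sym // xA.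
  by have /negbFE-> := B0 y.
have [u [v []]] := crossing_edge xA yA; rewrite {1}A1 inE => /eqP-> vA xv.
case/negP: (no_univ v); apply/forallP => z; apply/implyP => zv.
have [zA|zA] := boolP (z \in A).
  by move: zA; rewrite A1 inE => /eqP->; rewrite e_sym.
by apply: AB; rewrite 1?eq_sym // (negPf zA) (negPf vA).
Qed.

End CobipartiteGraphs.

(** * Isomorphisms as enumerations of the vertices *)

(** Reduces an isomorphism with a concrete graph to a list of vertices and finitely many adjacency
    checks; the map sends a vertex to its index in the list. *)
Lemma graph_iso_tupleP (T : finType) (e : rel T) n (h : rel 'I_n) :
  graph_iso e h <->
  exists s : n.-tuple T,
    [/\ uniq s, forall x, x \in s & forall i j, e (tnth s i) (tnth s j) = h i j].
Proof.
split=> [[f [g fK gK] h_f]|[s [s_uniq s_all e_s]]].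
  exists [tuple g i | i < n]; split.
  - by rewrite map_inj_uniq ?enum_uniq //; apply: can_inj gK.
  - by move=> x; rewrite -[x]fK; apply: map_f; rewrite mem_enum.
  - by move=> i j; rewrite !tnth_mktuple -h_f !gK.
have idx x : index x s < n by rewrite -[n in X in _ < X](size_tuple s) index_mem.
pose f x := Ordinal (idx x).
have fK : cancel f (tnth s) by move=> x; rewrite (tnth_nth x) nth_index.
exists f; last by move=> x y; rewrite -e_s !fK.
exists (tnth s) => // i; apply: val_inj => /=.
by rewrite (tnth_nth (tnth s i)) index_uniq // size_tuple.
Qed.

(** * Even trees on two and four vertices *)

Section SmallGraphs.

Variables (T : finType) (t : rel T).

Lemma leaf_unique_neighbour x y : (forall z, t x z = (z == y)) -> leaf t x.
Proof.
move=> tx; apply/eqP; rewrite /degree -(cards1 y); congr #|pred_of_set _|.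
by apply/setP => z; rewrite !inE tx.
Qed.

Hypothesis t_tree : even_tree t.

(** The tree would be a single edge, whose ends are leaves at distance one. *)
Lemma even_tree_not_two_vertices (a b : T) :
  uniq [:: a; b] -> ~ (forall x, x \in [:: a; b]).
Proof.
have [[[t_sym t_irr] t_conn _] t_even] := t_tree.
rewrite /= inE andbT => ab all_ab; have ba : b != a by rewrite eq_sym.
have tab : t a b.
  have [||u [v []]] := crossing_edge t_sym t_conn (A := [set a]) (x := a) (y := b); rewrite ?inE //.
  by move=> /eqP ->; have := all_ab v; rewrite !inE => /orP[]/eqP->; rewrite ?eqxx.
have la : leaf t a.
  apply: (@leaf_unique_neighbour a b) => z.
  by have := all_ab z; rewrite !inE => /orP[]/eqP->; rewrite ?eqxx ?t_irr ?(negPf ab).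
have lb : leaf t b.
  apply: (@leaf_unique_neighbour b a) => z.
  by have := all_ab z; rewrite !inE => /orP[]/eqP->; rewrite ?eqxx ?t_irr ?(negPf ba) // t_sym.
by have := t_even a b la lb ab [:: b]; rewrite /= tab inE ab => /(_ isT erefl isT).
Qed.

(** With [a d] missing as well, the cuts around [a], [d] and [{a, b}] can each be crossed in only
    one way, so the tree is the path [a b c d], whose end leaves are at odd distance three. *)
Lemma even_tree4_side (a b c d : T) :
  uniq [:: a; b; c; d] -> (forall x, x \in [:: a; b; c; d]) ->
  ~~ t a c -> ~~ t b d -> t a d.
Proof.
have [[[t_sym t_irr] t_conn _] t_even] := t_tree.
move=> uniq_s all_s ac bd; apply: contraT => ad.
have : [&& a != b, a != c, a != d, b != c, b != d & c != d].
  by move: uniq_s; rewrite /= !inE !negb_or -!andbA andbT.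
case/and5P=> ab a_c a_d bc /andP[b_d cd].
have cases (P : T -> Prop) : P a -> P b -> P c -> P d -> forall x, P x.
  by move=> ? ? ? ? x; have := all_s x; rewrite !inE => /or4P[]/eqP->.
have step (A : {set T}) x y : x \in A -> y \notin A -> exists u v, [/\ u \in A, v \notin A & t u v].
  exact: crossing_edge.
have tab : t a b.
  have bA : b \notin [set a] by rewrite inE eq_sym.
  have [u [v [/set1P-> + tav]]] := step _ _ _ (set11 a) bA; rewrite inE.
  elim/cases: v tav => //; rewrite ?eqxx ?(negPf ac) ?(negPf ad) //.
have tcd : t c d.
  have cA : c \notin [set d] by rewrite inE.
  have [u [v [/set1P-> + tdv]]] := step _ _ _ (set11 d) cA; rewrite inE; rewrite t_sym in tdv.
  elim/cases: v tdv => //; rewrite ?eqxx ?(negPf bd) ?(negPf ad) //.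
have tbc : t b c.
  have cA : c \notin [set a; b] by rewrite !inE negb_or ![c == _]eq_sym a_c.
  have [u [v [/set2P uE + tuv]]] := step _ _ _ (set21 a b) cA; rewrite !inE.
  case: uE tuv => ->; elim/cases: v => //;
    rewrite ?eqxx ?orbT ?(negPf ac) ?(negPf ad) ?(negPf bd) //.
have la : leaf t a.
  apply: (@leaf_unique_neighbour a b); elim/cases; rewrite ?eqxx ?t_irr ?tab ?(negPf ac) ?(negPf ad) ?(negPf ab) //.
  + by rewrite eq_sym (negPf bc).
  + by rewrite eq_sym (negPf b_d).
have ld : leaf t d.
  apply: (@leaf_unique_neighbour d c); elim/cases; rewrite ?eqxx ?t_irr ?[t d _]t_sym ?tcd
    ?(negPf ad) ?(negPf bd) ?(negPf a_c) ?(negPf bc) //.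
  by rewrite eq_sym (negPf cd).
have := t_even a d la ld a_d [:: b; c; d]; rewrite uniq_s /= tab tbc tcd.
by move=> /(_ isT erefl isT).
Qed.

(** Without both diagonals, [even_tree4_side] applies to all four rotations of the list and yields
    every side of a 4-cycle. *)
Lemma even_tree4_diagonal (a b c d : T) :
  uniq [:: a; b; c; d] -> (forall x, x \in [:: a; b; c; d]) ->
  ~~ t a c -> t b d.
Proof.
have [[[t_sym _] _ t_acyc] _] := t_tree.
move=> uniq_s all_s ac; apply: contraT => bd.
have rot_all i x : x \in rot i [:: a; b; c; d] by rewrite mem_rot.
have rot_uniq i : uniq (rot i [:: a; b; c; d]) by rewrite rot_uniq.
have tad := even_tree4_side uniq_s all_s ac bd.
have tba : t b a by apply: (even_tree4_side (rot_uniq 1) (rot_all 1)); rewrite // t_sym.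
have tcb : t c b by apply: (even_tree4_side (rot_uniq 2) (rot_all 2)); rewrite // t_sym.
have tdc : t d c by apply: (even_tree4_side (rot_uniq 3) (rot_all 3)); rewrite // t_sym.
case: (t_acyc [:: a; b; c; d]) => //.
by rewrite /ucycle uniq_s /= t_sym tba t_sym tcb t_sym tdc t_sym tad.
Qed.

End SmallGraphs.

Lemma even_tree_exceptions (T : finType) (e : rel T) :
  has_spanning_even_tree e ->
  ~ [\/ graph_iso e (complete_graph 2),
        graph_iso e (path_graph 4)
      | graph_iso e (cycle_graph 4)].
Proof.
case=> t [t_e t_tree].
(* The path and the cycle are handled together: both lack the pairs 0, 2 and 1, 3. *)
have no4 (h : rel 'I_4) :
    ~~ h (Ordinal (isT : 0 < 4)) (Ordinal (isT : 2 < 4)) ->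
    ~~ h (Ordinal (isT : 1 < 4)) (Ordinal (isT : 3 < 4)) -> ~ graph_iso e h.
  move=> + + /graph_iso_tupleP[[[|a [|b [|c [|d []]]]] // s_size] [s_uniq s_all e_s]].
  rewrite -!e_s !(tnth_nth a) /= => /(contra (@t_e _ _)) ac.
  by move=> /negP; apply; apply: t_e; apply: (even_tree4_diagonal t_tree s_uniq s_all ac).
case; [|exact: no4..].
case/graph_iso_tupleP=> -[[|a [|b []]] // s_size] [s_uniq s_all _].
exact: (even_tree_not_two_vertices t_tree s_uniq s_all).
Qed.

(** * Recognising the exceptional graphs *)

Lemma complete2_iso (T : finType) (e : rel T) u :
  simple_graph e -> #|T| = 2 -> universal e u -> graph_iso e (complete_graph 2).
Proof.
move=> [e_sym e_irr] T2 /forallP u_univ.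
have /card_gt0P[v vu] : 0 < #|[set~ u]| by rewrite cardsC1 T2.
rewrite !inE in vu; have uv : e u v := implyP (u_univ v) vu.
have s_uniq : uniq [:: u; v] by rewrite /= inE eq_sym vu.
apply/graph_iso_tupleP; exists [tuple u; v]; split=> //.
  have sub_s : {subset [:: u; v] <= enum T} by move=> x _; rewrite mem_enum.
  have [|_ eq_s] := uniq_min_size s_uniq sub_s; first by rewrite -cardE T2.
  by move=> x; rewrite eq_s mem_enum.
by do 2![case=> [[|[|//]] ?]]; rewrite !(tnth_nth u) /= ?e_irr ?uv // e_sym uv.
Qed.

(** Only the pair [a], [d] is undetermined: an edge there closes the cycle, a non-edge leaves the
    path. *)
Lemma path4_or_cycle4_iso (T : finType) (e : rel T) (a b c d : T) :
  simple_graph e -> uniq [:: a; b; c; d] -> (forall x, x \in [:: a; b; c; d]) ->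
  e a b -> e b c -> e c d -> ~~ e a c -> ~~ e b d ->
  graph_iso e (path_graph 4) \/ graph_iso e (cycle_graph 4).
Proof.
move=> [e_sym e_irr] s_uniq s_all ab bc cd /negPf ac /negPf bd.
have [ad|/negPf ad] := boolP (e a d); [right|left];
  apply/graph_iso_tupleP; exists [tuple a; b; c; d]; split=> //;
  do 2![case=> [[|[|[|[|//]]]] ?]]; rewrite !(tnth_nth a) /=;
  by rewrite ?e_irr ?ab ?bc ?cd ?ac ?bd ?ad // e_sym ?ab ?bc ?cd ?ac ?bd ?ad.
Qed.

(** * Case analysis on a universal vertex and on the clique sizes *)

Theorem theorem6 (T : finType) (e : rel T)
  (simple_e : simple_graph e) (card_T : 2 <= #|T|)
  (conn_e : connected_graph e) (cobip_e : cobipartite e) :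
  has_spanning_even_tree e <->
  ~ [\/ graph_iso e (complete_graph 2),
        graph_iso e (path_graph 4)
      | graph_iso e (cycle_graph 4)].
Proof.
split=> [|no_iso]; first exact: even_tree_exceptions.
have [e_sym e_irr] := simple_e.
have [h [_ [A h_A] e_h]] := cobip_e.
have AB : two_cliques e A.
  move=> x y xy xyA; rewrite e_h /complement_graph /= xy /=.
  by apply/negP => /h_A; rewrite xyA eqxx.
have [/existsP[u u_univ]|no_univ] := boolP [exists u, universal e u].
  case: (ltngtP 2 #|T|) card_T => // [T_gt2|T2] _; first exact: star_spanning_even_tree u_univ _.
  by case: no_iso; constructor 1; apply: complete2_iso u_univ.
have {}no_univ u : ~~ universal e u by move: u; apply/existsPn.
have [x0 _] : exists x, x \in T by apply/card_gt0P; apply: ltnW.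
have A_gt1 : 1 < #|A| by apply: (clique_gt1 _ _ x0 AB).
have B_gt1 : 1 < #|~: A| by apply: (clique_gt1 _ _ x0 (two_cliquesC AB)).
have [b bA] : exists b, b \notin A.
  by have /card_gt0P[b] := ltnW B_gt1; rewrite inE => bA; exists b.
have [a aA] : exists a, a \in A by apply/card_gt0P; apply: ltnW.
have {a b aA bA} [a [b [aA bA ab]]] := crossing_edge e_sym conn_e aA bA.
have [A_le2|A_gt2] := leqP #|A| 2; last exact: double_star_spanning_even_tree AB aA bA ab _ _.
have [B_le2|B_gt2] := leqP #|~: A| 2; last first.
  (* The cliques exchange roles, and the crossing edge is read from [b] to [a]. *)
  by apply: (double_star_spanning_even_tree e_sym (two_cliquesC AB) (x := b) (y := a));
    rewrite ?setCK ?inE ?negbK // e_sym.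
have /cards1P[a' A1] : #|A :\ a| == 1.
  by move: A_le2 A_gt1; rewrite (cardsD1 a) aA !ltnS => A_le1 A_ge1; rewrite eqn_leq A_le1.
have /cards1P[b' B1] : #|~: A :\ b| == 1.
  by move: B_le2 B_gt1; rewrite (cardsD1 b) inE bA !ltnS => B_le1 B_ge1; rewrite eqn_leq B_le1.
have : a' \in A :\ a by rewrite A1 set11.
have : b' \in ~: A :\ b by rewrite B1 set11.
rewrite !inE => /andP[b'b b'A] /andP[a'a a'A].
have all_s x : x \in [:: a'; a; b; b'].
  (* Replacing [x == a'] and [x == b'] by membership in [A :\ a] and [~: A :\ b] leaves a Boolean
     tautology in [x == a], [x == b] and [x \in A]. *)
  have := in_set1 x a'; have := in_set1 x b'; rewrite -A1 -B1 !inE => <- <-.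
  by case: (x == a); case: (x == b); case: (x \in A).
have neqA u v : u \in A -> v \notin A -> u != v.
  by move=> uA; apply: contraNneq => <-.
have uniq_s : uniq [:: a'; a; b; b'] by rewrite /= !inE !negb_or a'a [b == _]eq_sym b'b !neqA.
have a'_a : e a' a by apply: AB => //; rewrite aA.
have b_b' : e b b' by apply: AB; rewrite 1?eq_sym // (negPf bA) (negPf b'A).
have cases (P : T -> Prop) : P a' -> P a -> P b -> P b' -> forall x, P x.
  by move=> ? ? ? ? x; have := all_s x; rewrite !inE => /or4P[]/eqP->.
(* [a] is already adjacent to [a'] and [b], so an edge to [b'] would make it universal; likewise for
   [b] and [a'] below. These are the two missing diagonals of [a' a b b']. *)
have ab' : ~~ e a b'.
  apply: contraNN (no_univ a) => ab'; apply/forallP.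
  by elim/cases; rewrite ?eqxx ?ab ?ab' 1?e_sym ?a'_a ?implybT.
have a'b : ~~ e a' b.
  apply: contraNN (no_univ b) => a'b; apply/forallP.
  by elim/cases; rewrite ?eqxx ?b_b' 1?e_sym ?ab ?a'b ?implybT.
case: no_iso.
by have [] := path4_or_cycle4_iso simple_e uniq_s all_s a'_a ab b_b' a'b ab';
  [constructor 2|constructor 3].
Qed.
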